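(* Let $a,b,d>0$, let $c_-$ be the unique negative zero of $Q(x)=4ax^3-b^2x^2-18abd\,x+27a^2d^2+4db^3$, let $c^*=-\sqrt{3bd}$, and assume $c\in(c_-,c^* )$. Let $\phi(x)=\frac{ax^3+bx^2+cx+d}{x^3}$ ($x>0$) and $x_m=\frac{-c-\sqrt{c^2-3bd}}{b}$. Assume $\phi$ has two equilibria $\overline{t}_1<\overline{t}_2$, and let $\{t_n\}_{n\ge0}$ be a positive solution of $t_{n+1}=\phi(t_n)$. \begin{description} \item[(a)] Case $c=c_m$. Assume $\overline{t}_2\leq a$ and let $\delta<x_m$ be the unique number with $\phi(\delta)=\overline{t}_2$. Then: \begin{description} \item[(a1)] If $x_m\leq\overline{t}_1$: $\{t_n\}$ converges to $\overline{t}_1$ if $t_0\in(\delta,\overline{t}_2)$, and otherwise converges to $\overline{t}_2$. \item[(a2)] If $\overline{t}_1<x_m$: \begin{description} \item[(a21)] if $\phi$ has no 2-cycle, then $\{t_n\}$ converges to $\overline{t}_1$ if $t_0\in(\delta,\overline{t}_2)$, and otherwise converges to $\overline{t}_2$; \item[(a22)] if $\phi$ has one 2-cycle $(p,q)$ with $p<\overline{t}_1<q\leq x_m$, let $I=[\phi(x_m),\phi^2(x_m)]$ and $\mathcal{S}=\{t>0:\phi^n(t)=\overline{t}_1\text{ for some }n\geq0\}$. Then $\{t_n\}$ converges to the 2-cycle $(p,q)$ if $t_0\in(\delta,\overline{t}_2)\setminus\mathcal{S}$, converges to $\overline{t}_1$ if $t_0\in\mathcal{S}$, and otherwise converges to $\overline{t}_2$.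 In particular, if $t_0\in I\setminus\{\overline{t}_1\}$ then $\{t_n\}$ converges to the 2-cycle $(p,q)$. \end{description} \end{description} \item[(b)] Case $c=c_M$. Assume $\overline{t}_1\leq a$ and let $\delta'<x_m$ be the unique number with $\phi(\delta')=\overline{t}_1$. Then $\{t_n\}$ converges to $\overline{t}_1$ if $t_0\in[\delta',\overline{t}_1]$, and otherwise converges to $\overline{t}_2$. \end{description}
   Context: $x_m$ is the local minimum point of $\phi$. An equilibrium is $t>0$ with $\phi(t)=t$, equivalently a positive root of $P(t)=t^4-at^3-bt^2-ct-d$. Let $c_b$ be the unique negative root of $H(x)=108x^2+(108ab+27a^3)x-9a^2b^2-32b^3$. When $c_b<\frac{b^2-12d}{3a}$, as the parameter $c$ increases from $c_b$ (with $a,b,d$ fixed), $P$ first acquires a positive double root $t_m$ at a local minimum of $P$, and later a positive double root $t_M$ at a local maximum of $P$; $c_m$ and $c_M$ denote the corresponding values of $c$. For $c\in(c_-,c^* )$, $\phi$ has exactly two equilibria only when $c=c_m$ or $c=c_M$. A 2-cycle is a pair $(p,q)$ of positive numbers with $p\ne q$, $\phi(p)=q$, $\phi(q)=p$. A positive solution is a sequence with $t_0>0$ and $t_{n+1}=\phi(t_n)$. The sequence $\{t_n\}$ converges to the 2-cycle $(p,q)$ if one of the subsequences $\{t_{2n}\}$, $\{t_{2n+1}\}$ converges to $p$ and the other to $q$. *)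

(* Defs.v *)
From Stdlib Require Export Reals Lra.
Open Scope R_scope.

Definition phi (a b c d x : R) : R := (a*x^3 + b*x^2 + c*x + d) / x^3.

Definition Pq (a b c d t : R) : R := t^4 - a*t^3 - b*t^2 - c*t - d.
Definition dPq (a b c d t : R) : R := 4*t^3 - 3*a*t^2 - 2*b*t - c.

Definition Qc (a b d x : R) : R :=
  4*a*x^3 - b^2*x^2 - 18*a*b*d*x + 27*a^2*d^2 + 4*d*b^3.
Definition Hc (a b x : R) : R :=
  108*x^2 + (108*a*b + 27*a^3)*x - 9*a^2*b^2 - 32*b^3.

Definition xm (a b c d : R) : R := (- c - sqrt (c^2 - 3*b*d)) / b.
Definition cstar (b d : R) : R := - sqrt (3*b*d).

Definition local_min (f : R -> R) (t : R) : Prop :=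
  exists eps, 0 < eps /\ forall s, Rabs (s - t) < eps -> f t <= f s.
Definition local_max (f : R -> R) (t : R) : Prop :=
  exists eps, 0 < eps /\ forall s, Rabs (s - t) < eps -> f s <= f t.

Definition dbl_root_min (a b c d : R) : Prop :=
  exists t, 0 < t /\ Pq a b c d t = 0 /\ dPq a b c d t = 0 /\ local_min (Pq a b c d) t.
Definition dbl_root_max (a b c d : R) : Prop :=
  exists t, 0 < t /\ Pq a b c d t = 0 /\ dPq a b c d t = 0 /\ local_max (Pq a b c d) t.

Definition is_cb (a b x : R) : Prop :=
  x < 0 /\ Hc a b x = 0 /\ forall y, y < 0 -> Hc a b y = 0 -> y = x.

Definition is_cm (a b d c : R) : Prop :=
  exists cb, is_cb a b cb /\ cb < (b^2 - 12*d)/(3*a) /\ cb < c /\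
    dbl_root_min a b c d /\
    (forall c', cb < c' < c -> ~ dbl_root_min a b c' d).

Definition is_cM (a b d c : R) : Prop :=
  exists cb cm, is_cb a b cb /\ cb < (b^2 - 12*d)/(3*a) /\ is_cm a b d cm /\
    cm < c /\ dbl_root_max a b c d /\
    (forall c', cm < c' < c -> ~ dbl_root_max a b c' d).

Definition is_2cycle (f : R -> R) (p q : R) : Prop :=
  0 < p /\ 0 < q /\ p <> q /\ f p = q /\ f q = p.

Definition cv_2cycle (t : nat -> R) (p q : R) : Prop :=
  (Un_cv (fun n => t (2*n)%nat) p /\ Un_cv (fun n => t (2*n+1)%nat) q) \/
  (Un_cv (fun n => t (2*n)%nat) q /\ Un_cv (fun n => t (2*n+1)%nat) p).

Definition eventually_hits (f : R -> R) (x s : R) : Prop :=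
  0 < s /\ exists n : nat, Nat.iter n f s = x.

(* Main.v *)
(* phi decreases on (0, m], increases on [m, M] (m = x_m) and decreases to a
   afterwards, and the double root of P pins down the sign of phi(x) - x. Where
   phi, or phi o phi on the core interval [phi(m), m], is increasing, orbits are
   monotone. Two points need more. In (a22) the 2-cycle must attract from both
   sides: in the variable 1/x, phi is a cubic with real critical points, so it has
   negative Schwarzian derivative, and this forces phi'(p) phi'(q) < 1 for any
   2-cycle below m. In (b) the fixed point t2 may lie on the last decreasing
   branch; there x phi(x) is increasing on [m, oo), so |ln (x / t2)| decreases
   along orbits. *)

Require Import Defs.
From Stdlib Require Import Psatz Lia Classical Ranalysis5.

(** * Convergence of sequences: shifts, parity, and a contraction criterion *)

Lemma Un_cv_shift (t : nat -> R) (N : nat) (l : R) :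
  Un_cv (fun n => t (n + N)%nat) l -> Un_cv t l.
Proof.
intros H eps He. destruct (H eps He) as [K HK]. exists (K + N)%nat. intros n Hn.
replace n with ((n - N) + N)%nat by lia. apply HK. lia.
Qed.

Lemma Un_cv_even_odd (t : nat -> R) (l : R) :
  Un_cv (fun n => t (2 * n)%nat) l -> Un_cv (fun n => t (2 * n + 1)%nat) l -> Un_cv t l.
Proof.
intros He Ho eps Heps.
destruct (He eps Heps) as [N1 H1]. destruct (Ho eps Heps) as [N2 H2].
exists (2 * (N1 + N2) + 1)%nat. intros n Hn.
destruct (Nat.Even_or_Odd n) as [[k Hk]|[k Hk]]; rewrite Hk.
- apply H1. lia.
- apply H2. lia.
Qed.

(** Dropping one term swaps the even and odd subsequences; the symmetric form of [cv_2cycle] absorbs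
    the swap, hence the induction on [N]. *)
Lemma cv_2cycle_shift (t : nat -> R) (p q : R) (N : nat) :
  cv_2cycle (fun n => t (n + N)%nat) p q -> cv_2cycle t p q.
Proof.
assert (ext : forall u v, (forall n, u n = v n) -> cv_2cycle u p q -> cv_2cycle v p q).
{ intros u v E [[H1 H2]|[H1 H2]]; [left|right]; split.
  all: first [exact (Un_cv_ext _ _ (fun n => E _) _ H1)|exact (Un_cv_ext _ _ (fun n => E _) _ H2)]. }
revert t. induction N as [|N IH]; intros t H.
- apply ext with (2 := H). intros n. now rewrite Nat.add_0_r.
- assert (H' : cv_2cycle (fun n => t (S n)) p q).
  { apply IH. apply ext with (2 := H). intros n. now rewrite Nat.add_succ_r. }
  assert (E : forall l, Un_cv (fun n => t (S (2 * n))) l -> Un_cv (fun n => t (2 * n + 1)%nat) l).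
  { intros l. apply Un_cv_ext. intros n. now rewrite Nat.add_1_r. }
  assert (O : forall l, Un_cv (fun n => t (S (2 * n + 1))) l -> Un_cv (fun n => t (2 * n)%nat) l).
  { intros l Hl. apply Un_cv_shift with 1%nat. revert Hl. apply Un_cv_ext. intros n. f_equal. lia. }
  destruct H' as [[H1 H2]|[H1 H2]]; [right|left]; split; auto.
Qed.

Lemma continuity_pt_between (f : R -> R) (y l u : R) :
  continuity_pt f y -> l < f y < u ->
  exists e, 0 < e /\ forall x, Rabs (x - y) < e -> l < f x < u.
Proof.
intros Hc [Hl Hu].
destruct (Hc (Rmin (f y - l) (u - f y))) as [e [He H]].
{ apply Rlt_gt, Rmin_glb_lt; lra. }
exists e. split; [lra|]. intros x Hx.
destruct (Req_dec x y) as [->|Hne]; [lra|].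
assert (Hd : Rabs (f x - f y) < Rmin (f y - l) (u - f y)).
{ apply (H x). split; [split; [exact I|congruence]|exact Hx]. }
pose proof (Rmin_l (f y - l) (u - f y)). pose proof (Rmin_r (f y - l) (u - f y)).
apply Rabs_def2 in Hd. lra.
Qed.

(* The hypotheses say that [x <> z] in [D] implies
   [|ln (f x / z)| < |ln (x / z)|]; the proof follows [V x = exp |ln (x / z)|]. *)
Lemma log_contraction_cv (f : R -> R) (D : R -> Prop) (z : R) (t : nat -> R) :
  D z -> f z = z ->
  (forall x y w, D x -> D w -> x <= y <= w -> D y) ->
  (forall x, D x -> 0 < x) ->
  (forall x, D x -> D (f x)) ->
  (forall x, D x -> continuity_pt f x) ->
  (forall x, D x -> x < z -> x < f x /\ x * f x < z^2) ->
  (forall x, D x -> z < x -> f x < x /\ z^2 < x * f x) ->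
  D (t 0%nat) -> (forall n, t (S n) = f (t n)) -> Un_cv t z.
Proof.
intros Dz fz Dc Dpos Df fc Hlo Hhi D0 Ht.
assert (Hz := Dpos z Dz).
assert (Dn : forall n, D (t n)) by (induction n; [|rewrite Ht]; auto).
set (V := fun x => Rmax (x / z) (z / x)).
assert (V1 : forall x, D x -> 1 <= V x).
{ intros x Hx. assert (Hx0 := Dpos x Hx). unfold V. destruct (Rle_dec z x).
  - apply Rle_trans with (x / z); [|apply Rmax_l].
    apply Rmult_le_reg_r with z; [lra|]. field_simplify; lra.
  - apply Rle_trans with (z / x); [|apply Rmax_r].
    apply Rmult_le_reg_r with x; [lra|]. field_simplify; lra. }
assert (Vlt : forall x B, D x -> 0 < B -> (V x < B <-> z / B < x < z * B)).
{ intros x B Hx HB. assert (Hx0 := Dpos x Hx). unfold V.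
  assert (E1 : x / z < B <-> x < z * B).
  { split; intro H.
    - apply (Rmult_lt_compat_r z) in H; [|lra]. field_simplify in H; lra.
    - apply Rmult_lt_reg_r with z; [lra|]. field_simplify; lra. }
  assert (E2 : z / x < B <-> z / B < x).
  { split; intro H.
    - apply (Rmult_lt_compat_r x) in H; [|lra]. apply Rmult_lt_reg_r with B; [lra|].
      field_simplify in H; [|lra]. field_simplify; lra.
    - apply (Rmult_lt_compat_r B) in H; [|lra]. apply Rmult_lt_reg_r with x; [lra|].
      field_simplify in H; [|lra]. field_simplify; lra. }
  rewrite <- E1, <- E2. split; intro H.
  - split; [apply Rle_lt_trans with (2 := H), Rmax_r|apply Rle_lt_trans with (2 := H), Rmax_l].
  - now apply Rmax_lub_lt. }
(* One application of [f] gets strictly inside level [B], even from [V x = B]: moving towards [z]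
   bounds one side, and the hypothesis on [x * f x] bounds a jump across [z]. *)
assert (Vf : forall x B, D x -> 1 < B -> V x <= B -> z / B < f x < z * B).
{ intros x B Hx HB HV. assert (Hx0 := Dpos x Hx). assert (Hf0 := Dpos _ (Df x Hx)).
  assert (Hxz : x <= z * B /\ z <= x * B).
  { unfold V in HV. pose proof (Rmax_l (x / z) (z / x)). pose proof (Rmax_r (x / z) (z / x)).
    split.
    - apply Rmult_le_reg_r with (/ z); [now apply Rinv_0_lt_compat|]. field_simplify; lra.
    - apply Rmult_le_reg_r with (/ x); [now apply Rinv_0_lt_compat|]. field_simplify; lra. }
  assert (Hg : z < f x * B /\ f x < z * B).
  { destruct (Rtotal_order x z) as [H|[->|H]].
    - destruct (Hlo x Hx H) as [H1 H2]. split; [nra|].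
      apply Rmult_lt_reg_l with x; [lra|]. nra.
    - rewrite fz. split; nra.
    - destruct (Hhi x Hx H) as [H1 H2]. split; [|nra].
      apply Rmult_lt_reg_l with x; [lra|]. nra. }
  split; [|lra]. apply Rmult_lt_reg_r with B; [lra|]. field_simplify; lra. }
assert (Vdec : Un_decreasing (fun n => V (t n))).
{ intros n. rewrite Ht. assert (H1 := V1 _ (Dn n)).
  destruct (Req_dec (V (t n)) 1) as [E|E].
  - rewrite E. apply Rnot_lt_le. intro HV.
    assert (V (f (t n)) < V (f (t n))); [|lra].
    apply Vlt; [apply Df, Dn|lra|]. apply Vf; [apply Dn|lra|lra].
  - left. apply Vlt; [apply Df, Dn|lra|]. apply Vf; [apply Dn|lra|lra]. }
destruct (decreasing_cv _ Vdec) as [L HL].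
{ exists (-1). intros y [n ->]. unfold opp_seq. specialize (V1 _ (Dn n)). lra. }
assert (VL := decreasing_ineq _ _ Vdec HL). simpl in VL.
(* If [L > 1], level [L] consists of [z * L] and [z / L]. Points of [D] close to these and outside
   the level are sent strictly inside it, so the orbit drops below [L], contradicting [VL]. *)
assert (L1 : L <= 1).
{ apply Rnot_lt_le. intro HL1.
  assert (near : forall y, 0 < y -> z / L <= y <= z * L ->
    exists e, 0 < e /\ forall x, D x -> (y <= x /\ z <= y \/ x <= y /\ y <= z) ->
      Rabs (x - y) < e -> z / L < f x < z * L).
  { intros y Hy0 Hy. destruct (classic (D y)) as [Dy|Dy].
    - destruct (continuity_pt_between f y (z / L) (z * L)) as [e [He H]]; [now apply fc| |].
      + apply Vf; [assumption|lra|]. unfold V.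
        assert (z <= y * L).
        { apply (Rmult_le_reg_r (/ L)); [apply Rinv_0_lt_compat; lra|].
          replace (y * L * / L) with y by (field; lra). apply Hy. }
        apply Rmax_lub.
        * apply Rmult_le_reg_r with z; [lra|]. field_simplify; lra.
        * apply Rmult_le_reg_r with y; [lra|]. field_simplify; lra.
      + exists e. split; [assumption|]. intros x _ _. apply H.
    (* [D] need not be closed: if [y] is missing from it, convexity leaves no point of [D] on the
       far side of [y]. *)
    - exists 1. split; [lra|]. intros x Dx Hx. exfalso. apply Dy.
      destruct Hx as [Hx|Hx]; [apply Dc with z x|apply Dc with x z]; tauto. }
  assert (HzL : z / L <= z).
  { apply Rmult_le_reg_r with L; [lra|]. field_simplify; nra. }
  assert (HzL0 : 0 < z / L) by (apply Rdiv_lt_0_compat; lra).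
  destruct (near (z * L)) as [e1 [He1 N1]]; [nra|nra|].
  destruct (near (z / L)) as [e2 [He2 N2]]; [lra|nra|].
  set (e := Rmin e1 e2).
  assert (He : 0 < e) by now apply Rmin_glb_lt.
  assert (Hee1 := Rmin_l e1 e2 : e <= e1). assert (Hee2 := Rmin_r e1 e2 : e <= e2).
  destruct (HL (e / z)) as [N HN]; [now apply Rdiv_lt_0_compat|].
  specialize (HN N (le_n N)). unfold Rdist in HN. apply Rabs_def2 in HN.
  assert (HVn : V (t N) < L + e / z) by lra.
  assert (Hez : 0 < e / z) by now apply Rdiv_lt_0_compat.
  apply Vlt in HVn; [|apply Dn|lra].
  (* The condition [V < L + e / z] reaches at most [e] beyond either end of [[z / L, z * L]]. *)
  assert (Hgap : z / L - z / (L + e / z) < e).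
  { replace (z / L - z / (L + e / z)) with (e * (z / (L * (L * z + e)))) by (field; nra).
    rewrite <- (Rmult_1_r e) at 3. apply Rmult_lt_compat_l; [lra|].
    assert (HK : z < L * (L * z + e)) by (assert (z < L * z) by nra; nra).
    apply Rmult_lt_reg_r with (L * (L * z + e)); [lra|].
    replace (z / (L * (L * z + e)) * (L * (L * z + e))) with z by (field; split; nra). lra. }
  replace (z * (L + e / z)) with (z * L + e) in HVn by (field; lra).
  assert (Hcontra : V (t (S N)) < L); [|specialize (VL (S N)); lra].
  rewrite Ht. apply Vlt; [apply Df, Dn|lra|].
  destruct (Rle_dec (z * L) (t N)) as [H|H].
  - apply N1; [apply Dn|left; split; nra|apply Rabs_def1; lra].
  - destruct (Rle_dec (t N) (z / L)) as [H'|H'].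
    + apply N2; [apply Dn|right; split; nra|apply Rabs_def1; lra].
    + exfalso. assert (V (t N) < L) by (apply Vlt; [apply Dn|lra|lra]). specialize (VL N). lra. }
intros eps He. destruct (HL (eps / z)) as [N HN]; [now apply Rdiv_lt_0_compat|].
exists N. intros n Hn. specialize (HN n Hn). unfold Rdist in *. apply Rabs_def2 in HN.
assert (Hez : 0 < eps / z) by now apply Rdiv_lt_0_compat.
assert (HVn : V (t n) < 1 + eps / z) by lra.
apply Vlt in HVn; [|apply Dn|lra].
assert (z - z / (1 + eps / z) < eps).
{ replace (z - z / (1 + eps / z)) with (eps * (z / (z + eps))) by (field; lra).
  rewrite <- (Rmult_1_r eps) at 3. apply Rmult_lt_compat_l; [lra|].
  apply Rmult_lt_reg_r with (z + eps); [lra|]. field_simplify; lra. }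
replace (z * (1 + eps / z)) with (z + eps) in HVn by (field; lra).
apply Rabs_def1; lra.
Qed.

(** * Positivity and monotonicity of [phi] *)

(** As a function of [c], [Qc] is minus the discriminant of the cubic. At [cminus] the cubic touches
    zero at a positive double root and is nonnegative for [x > 0]; raising [c] adds a positive
    multiple of [x]. *)
Lemma cubic_pos (a b c d cminus : R) :
  0 < a -> 0 < b -> 0 < d ->
  (forall x, x < 0 -> Qc a b d x = 0 -> x = cminus) -> cminus < c ->
  forall x, 0 < x -> 0 < a * x^3 + b * x^2 + c * x + d.
Proof.
intros Ha Hb Hd HQ Hc x Hx.
(* A positive [r] is a double root of the cubic for some choice of [c] exactly when [h r = 0]. *)
set (h := fun r => 2 * a * r^3 + b * r^2 - d).
destruct (IVT_interv h 0 (1 + d / b)) as [r [Hr Hr0]].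
- intros r _. apply derivable_continuous_pt. unfold h. reg.
- apply Rplus_lt_0_compat; [lra|now apply Rdiv_lt_0_compat].
- unfold h. nra.
- unfold h. assert (Hdb : 0 < d / b) by now apply Rdiv_lt_0_compat.
  replace (2 * a * (1 + d / b)^3 + b * (1 + d / b)^2 - d)
    with (2 * a * (1 + d / b)^3 + b + d + d * (d / b)) by (field; lra).
  assert (0 < (1 + d / b)^3) by (apply pow_lt; lra).
  assert (0 < a * (1 + d / b)^3) by now apply Rmult_lt_0_compat.
  assert (0 < d * (d / b)) by now apply Rmult_lt_0_compat. lra.
- unfold h in Hr0.
  assert (Hr1 : 0 < r). { destruct (proj1 Hr) as [H|H]; [exact H|subst r; nra]. }
  (* At [- (3 a r^2 + 2 b r)] the cubic acquires the double root [r]. *)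
  assert (Ed : d = 2 * a * r^3 + b * r^2) by lra.
  assert (Ec : - (3 * a * r^2 + 2 * b * r) = cminus).
  { apply HQ; [nra|]. unfold Qc. rewrite Ed. ring. }
  assert (E : a * x^3 + b * x^2 + c * x + d
    = (x - r)^2 * (a * x + (2 * a * r + b)) + (c - cminus) * x).
  { rewrite <- Ec, Ed. ring. }
  rewrite E. apply Rplus_le_lt_0_compat; [|nra].
  apply Rmult_le_pos; [apply pow2_ge_0|]. assert (0 < a * x) by nra. nra.
Qed.

Lemma phi_pos (a b c d x : R) :
  0 < x -> 0 < a * x^3 + b * x^2 + c * x + d -> 0 < phi a b c d x.
Proof. intros Hx H. apply Rdiv_lt_0_compat; [exact H|now apply pow_lt]. Qed.

Lemma phi_continuity_pt (a b c d x : R) : 0 < x -> continuity_pt (phi a b c d) x.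
Proof.
intros Hx. apply derivable_continuous_pt. unfold phi. reg.
apply pow_nonzero. lra.
Qed.

Lemma Pq_phi (a b c d x : R) : 0 < x -> Pq a b c d x = x^3 * (x - phi a b c d x).
Proof. intros Hx. unfold Pq, phi. field. lra. Qed.

(* Simpson's rule is exact for the cubic [phi (1/u)]. *)
Lemma phi_sub (a b c d x y : R) : 0 < x -> 0 < y ->
  let h w := (b * w^2 + 2 * c * w + 3 * d) / w^2 in
  phi a b c d x - phi a b c d y
    = (y - x) / (6 * x * y) * (h x + h y + 4 * h (2 * x * y / (x + y))).
Proof. intros Hx Hy h. unfold h, phi. field. nra. Qed.

(** The harmonic mean is the midpoint in the variable 1/x, that is, the inner Simpson node in
    [phi_sub]. *)
Lemma harmonic_mean_between (x y : R) : 0 < x -> x < y -> x < 2 * x * y / (x + y) < y.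
Proof.
intros Hx Hxy. split; apply Rmult_lt_reg_r with (x + y); try lra; field_simplify; nra.
Qed.

(** [xm] and [M] are the roots of [b x^2 + 2 c x + 3 d], the critical points of [phi]; they are real
    and distinct because [c < cstar b d] forces [c^2 > 3 b d]. Trading [c] and [d] for them makes
    the later signs visible. *)
Lemma xm_spec (a b c d : R) : 0 < b -> 0 < d -> c < cstar b d ->
  exists M, 0 < xm a b c d < M /\ c = - b * (xm a b c d + M) / 2 /\ d = b * xm a b c d * M / 3.
Proof.
intros Hb Hd Hc. unfold cstar in Hc. unfold xm.
assert (Hbd : 0 < 3 * b * d) by nra.
assert (Hs := sqrt_lt_R0 _ Hbd). assert (Hss := sqrt_sqrt (3 * b * d) ltac:(lra)).
assert (Hc2 : 0 < c^2 - 3 * b * d) by nra.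
assert (Hr := sqrt_lt_R0 _ Hc2). assert (Hrr := sqrt_sqrt (c^2 - 3 * b * d) ltac:(lra)).
set (r := sqrt (c^2 - 3 * b * d)) in *.
exists ((- c + r) / b). split; [split|split].
- apply Rdiv_lt_0_compat; nra.
- apply Rmult_lt_reg_r with b; [lra|]. field_simplify; lra.
- field. lra.
- apply Rmult_eq_reg_r with (3 * b); [|lra]. field_simplify; [|lra]. nra.
Qed.

Lemma phi_decreasing (a b c d m M x y : R) : 0 < b -> 0 < m < M ->
  c = - b * (m + M) / 2 -> d = b * m * M / 3 ->
  0 < x -> x < y -> y <= m \/ M <= x -> phi a b c d y < phi a b c d x.
Proof.
intros Hb HmM Ec Ed Hx Hxy Hpos.
assert (Hy : 0 < y) by lra. assert (Hw := harmonic_mean_between x y Hx Hxy).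
pose proof (phi_sub a b c d x y Hx Hy) as E. cbv zeta in E.
set (w := 2 * x * y / (x + y)) in *.
assert (Hh : forall v, x <= v <= y -> 0 <= (b * v^2 + 2 * c * v + 3 * d) / v^2).
{ intros v Hv. apply Rmult_le_pos; [|left; apply Rinv_0_lt_compat; nra].
  replace (b * v^2 + 2 * c * v + 3 * d) with (b * ((v - m) * (v - M))) by (subst c d; field).
  apply Rmult_le_pos; [lra|destruct Hpos; nra]. }
(* Strictness comes from the inner node: [x] or [y] may be a critical point, but [w] cannot. *)
assert (Hh' : 0 < (b * w^2 + 2 * c * w + 3 * d) / w^2).
{ apply Rdiv_lt_0_compat; [|nra].
  replace (b * w^2 + 2 * c * w + 3 * d) with (b * ((w - m) * (w - M))) by (subst c d; field).
  apply Rmult_lt_0_compat; [lra|destruct Hpos; nra]. }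
assert (0 < (y - x) / (6 * x * y)) by (apply Rdiv_lt_0_compat; nra).
assert (H1 := Hh x ltac:(lra)). assert (H2 := Hh y ltac:(lra)).
apply Rminus_gt. rewrite E. apply Rmult_lt_0_compat; lra.
Qed.

Lemma phi_increasing (a b c d m M x y : R) : 0 < b -> 0 < m < M ->
  c = - b * (m + M) / 2 -> d = b * m * M / 3 ->
  m <= x -> x < y -> y <= M -> phi a b c d x < phi a b c d y.
Proof.
intros Hb HmM Ec Ed Hmx Hxy HyM. assert (Hx : 0 < x) by lra.
assert (Hy : 0 < y) by lra. assert (Hw := harmonic_mean_between x y Hx Hxy).
pose proof (phi_sub a b c d x y Hx Hy) as E. cbv zeta in E.
set (w := 2 * x * y / (x + y)) in *.
assert (Hh : forall v, x <= v <= y -> 0 <= - ((b * v^2 + 2 * c * v + 3 * d) / v^2)).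
{ intros v Hv. unfold Rdiv. rewrite <- Ropp_mult_distr_l_reverse.
  apply Rmult_le_pos; [|left; apply Rinv_0_lt_compat; nra].
  replace (- (b * v^2 + 2 * c * v + 3 * d)) with (b * ((v - m) * (M - v))) by (subst c d; field).
  apply Rmult_le_pos; nra. }
assert (Hh' : 0 < - ((b * w^2 + 2 * c * w + 3 * d) / w^2)).
{ unfold Rdiv. rewrite <- Ropp_mult_distr_l_reverse.
  apply Rmult_lt_0_compat; [|apply Rinv_0_lt_compat; nra].
  replace (- (b * w^2 + 2 * c * w + 3 * d)) with (b * ((w - m) * (M - w))) by (subst c d; field).
  apply Rmult_lt_0_compat; nra. }
assert (0 < (y - x) / (6 * x * y)) by (apply Rdiv_lt_0_compat; nra).
assert (H1 := Hh x ltac:(lra)). assert (H2 := Hh y ltac:(lra)).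
apply Rminus_lt. rewrite E. nra.
Qed.

Lemma phi_tail (a b c d m M x : R) : 0 < b -> 0 < m < M ->
  c = - b * (m + M) / 2 -> d = b * m * M / 3 -> M <= x -> a < phi a b c d x.
Proof.
intros Hb HmM Ec Ed Hx. apply Rminus_gt.
replace (phi a b c d x - a) with (b / x^3 * (x^2 - (m + M) / 2 * x + m * M / 3))
  by (unfold phi; subst c d; field; lra).
apply Rmult_gt_0_compat; [apply Rdiv_lt_0_compat; [lra|apply pow_lt; lra]|nra].
Qed.

(** On [[m, M]] both factors are positive and increasing. Past [M], where [phi] decreases, the
    difference of the two products is factored and estimated with [u * v >= M * v] and
    [u + v <= 2 * v]. *)
Lemma mul_phi_increasing (a b c d m M x y : R) : 0 < a -> 0 < b -> 0 < m < M ->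
  c = - b * (m + M) / 2 -> d = b * m * M / 3 ->
  (forall z, 0 < z -> 0 < phi a b c d z) ->
  m <= x -> x < y -> x * phi a b c d x < y * phi a b c d y.
Proof.
intros Ha Hb HmM Ec Ed Hpos.
assert (H1 : forall x y, m <= x -> x < y -> y <= M -> x * phi a b c d x < y * phi a b c d y).
{ intros u v Hu Huv Hv.
  pose proof (phi_increasing a b c d m M u v Hb HmM Ec Ed Hu Huv Hv).
  assert (0 < phi a b c d u) by (apply Hpos; lra). nra. }
assert (H2 : forall x y, M <= x -> x < y -> x * phi a b c d x < y * phi a b c d y).
{ intros u v Hu Huv. apply Rminus_gt.
  replace (v * phi a b c d v - u * phi a b c d u)
    with ((v - u) / (u * v)^2 * (a * (u * v)^2 + b * ((m + M) / 2 * (u * v) - m * M / 3 * (u + v))))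
    by (unfold phi; subst c d; field; lra).
  assert (0 < u * v) by nra.
  apply Rmult_gt_0_compat; [apply Rdiv_lt_0_compat; nra|].
  assert (M * v <= u * v) by nra.
  assert (m * (M * v) < M * (M * v)) by (apply Rmult_lt_compat_r; nra).
  assert ((m + M) / 2 * (M * v) <= (m + M) / 2 * (u * v)) by (apply Rmult_le_compat_l; lra).
  assert (m * M / 3 * (u + v) <= m * M / 3 * (2 * v)) by (apply Rmult_le_compat_l; nra).
  assert (0 < a * (u * v)^2) by (apply Rmult_lt_0_compat; nra).
  assert (0 <= (m + M) / 2 * (u * v) - m * M / 3 * (u + v)) by nra.
  nra. }
intros Hx Hxy. destruct (Rle_dec y M); [auto|]. destruct (Rle_dec M x); [auto|].
apply Rlt_trans with (M * phi a b c d M); [apply H1|apply H2]; lra.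
Qed.

(* [S(q,q) S(p,p) < S(p,q)^2 = 1] for the divided difference [S] of [phi]:
   the infinitesimal form of the negative Schwarzian derivative. Hence
   [(phi o phi)' (q) < 1]. *)
Lemma two_cycle_attracting (a b c d m M p q : R) : 0 < b -> 0 < m < M ->
  c = - b * (m + M) / 2 -> d = b * m * M / 3 ->
  is_2cycle (phi a b c d) p q -> p < q -> q <= m ->
  exists e, 0 < e /\ forall x, q - e < x < q -> x < phi a b c d (phi a b c d x).
Proof.
intros Hb HmM Ec Ed [Hp [Hq [Hpq [Ep Eq]]]] Hlt Hqm.
set (S := fun x y => - (b / (x * y) + c * (x + y) / (x * y)^2
                       + d * (x^2 + x * y + y^2) / (x * y)^3)).
assert (HS : forall x y, 0 < x -> 0 < y -> phi a b c d x - phi a b c d y = (x - y) * S x y).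
{ intros x y Hx Hy. unfold phi, S. field. lra. }
assert (S1 : S p q = -1).
{ apply Rmult_eq_reg_l with (p - q); [|lra]. rewrite <- HS by assumption. rewrite Ep, Eq. ring. }
assert (Hdpos : 0 < d) by (subst d; assert (0 < b * m * M) by (repeat apply Rmult_lt_0_compat; lra); lra).
(* [3 d / x + c] is half the second derivative of the cubic in u = 1/x; it is positive because u
   lies at or past the larger critical point 1/m, hence past the inflection. *)
assert (Hdp : forall x, 0 < x -> x <= m -> 0 < 3 * d / x + c).
{ intros x Hx Hxm.
  replace (3 * d / x + c) with (b * (m * M - (m + M) / 2 * x) / x) by (subst c d; field; lra).
  apply Rdiv_lt_0_compat; [|lra]. apply Rmult_lt_0_compat; nra. }
assert (X := Hdp p Hp ltac:(lra)). assert (Y := Hdp q Hq Hqm).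
assert (S2 : S q q * S p p < 1).
{ apply Rminus_gt. replace 1 with (S p q * S p q) by (rewrite S1; ring).
  replace (S p q * S p q - S q q * S p p) with
    ((p - q)^2 / (p * q)^4
      * (((3 * d / p + c + (3 * d / q + c))^2 + 2 * ((3 * d / p + c) * (3 * d / q + c))) / 9
         + (c^2 / 3 - b * d)))
    by (unfold S; field; lra).
  apply Rmult_gt_0_compat.
  - apply Rdiv_lt_0_compat; [nra|]. apply pow_lt. nra.
  - replace (c^2 / 3 - b * d) with (b^2 * (M - m)^2 / 12) by (subst c d; field).
    assert (0 < (3 * d / p + c) * (3 * d / q + c)) by now apply Rmult_lt_0_compat.
    pose proof (pow2_ge_0 (b * (M - m))).
    replace (b^2 * (M - m)^2) with ((b * (M - m))^2) by ring.
    pose proof (pow2_ge_0 (3 * d / p + c + (3 * d / q + c))). lra. }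
(* By [HS] applied twice, [phi (phi x) - q] is [x - q] times this function, whose value at [q] is
   [S q q * S p p < 1]. *)
destruct (continuity_pt_between (fun x => S x q * S (phi a b c d x) p) q
  (S q q * S p p - 1) 1) as [e [He H]].
- assert (C : forall y x, 0 < x -> 0 < y -> continuity_pt (fun x => S x y) x).
  { intros y x Hx Hy. apply derivable_continuous_pt. unfold S. reg.
    all: try apply pow_nonzero; nra. }
  apply continuity_pt_mult; [now apply C|].
  apply (continuity_pt_comp (phi a b c d) (fun x => S x p)).
  + now apply phi_continuity_pt.
  + rewrite Eq. now apply C.
- rewrite Eq. lra.
(* This neighbourhood keeps [phi x] positive, and a radius at most [q] keeps [x] positive, so that
   [HS] applies to both. *)
- destruct (continuity_pt_between (phi a b c d) q 0 (2 * p)) as [e' [He' H']].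
  + now apply phi_continuity_pt.
  + lra.
  + pose proof (Rmin_l (Rmin e e') q). pose proof (Rmin_r (Rmin e e') q).
    pose proof (Rmin_l e e'). pose proof (Rmin_r e e').
    exists (Rmin (Rmin e e') q). split; [repeat apply Rmin_glb_lt; assumption|].
    intros x Hx. assert (Hd : Rabs (x - q) < Rmin (Rmin e e') q) by (apply Rabs_def1; lra).
    specialize (H x ltac:(lra)). specialize (H' x ltac:(lra)). simpl in H.
    pose proof (HS x q ltac:(lra) Hq) as E1.
    pose proof (HS (phi a b c d x) p ltac:(lra) Hp) as E2.
    rewrite Eq in E1. rewrite Ep in E2. rewrite E1 in E2. nra.
Qed.

(** Dividing [P] by [(x - z)^2] leaves a monic quadratic with root [w] and constant term
    [- d / z^2 < 0], so its other root is negative. For positive [x <> z], the sign of [P] is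
    therefore that of [x - w]. *)
Lemma Pq_factor (a b c d z w : R) : 0 < d -> 0 < z -> 0 < w -> w <> z ->
  Pq a b c d z = 0 -> dPq a b c d z = 0 -> Pq a b c d w = 0 ->
  exists s, 0 < s /\ forall x, Pq a b c d x = (x - z)^2 * (x - w) * (x + s).
Proof.
intros Hd Hz Hw Hwz Pz Dz Pw.
set (al := 2 * z - a). set (be := 3 * z^2 - 2 * a * z - b).
assert (F : forall x, Pq a b c d x = (x - z)^2 * (x^2 + al * x + be)).
{ intros x. transitivity (Pq a b c d x - Pq a b c d z - (x - z) * dPq a b c d z).
  - rewrite Pz, Dz. ring.
  - unfold Pq, dPq, al, be. ring. }
assert (R : w^2 + al * w + be = 0).
{ rewrite F in Pw. apply Rmult_integral in Pw. destruct Pw as [H|H]; [|exact H].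
  exfalso. apply Hwz. nra. }
assert (Hbe : be < 0).
{ pose proof (F 0) as F0. unfold Pq in F0. ring_simplify in F0. nra. }
exists (- be / w). split; [apply Rdiv_lt_0_compat; lra|].
intros x. rewrite F.
replace al with (- (w^2 + be) / w).
- field. lra.
- replace (w^2 + be) with (- (al * w)) by lra. field. lra.
Qed.

(** * Maps with one minimum followed by one maximum *)

(** The shape of [phi] on which the dynamical arguments rest, with [l] standing for its limit [a] at
    infinity. *)
Record bimodal (f : R -> R) (m M l : R) : Prop := {
  bm_crit : 0 < m < M;
  bm_pos : forall x, 0 < x -> 0 < f x;
  bm_cont : forall x, 0 < x -> continuity_pt f x;
  bm_dec : forall x y, 0 < x -> x < y -> y <= m -> f y < f x;
  bm_inc : forall x y, m <= x -> x < y -> y <= M -> f x < f y;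
  bm_tail : forall x, M <= x -> l < f x
}.

Lemma bimodal_dec_le f m M l x y : bimodal f m M l -> 0 < x -> x <= y -> y <= m -> f y <= f x.
Proof. intros B Hx [H| ->] Hy; [left; now apply (bm_dec _ _ _ _ B)|lra]. Qed.

Lemma bimodal_inc_le f m M l x y : bimodal f m M l -> m <= x -> x <= y -> y <= M -> f x <= f y.
Proof. intros B Hx [H| ->] Hy; [left; now apply (bm_inc _ _ _ _ B)|lra]. Qed.

(** This is where an equilibrium being at most [a] matters: past [M] the map falls again, but never
    to [l] or below, so the half-line above [z] stays invariant. *)
Lemma bimodal_above f m M l z x : bimodal f m M l ->
  m < z < M -> z <= l -> f z = z -> z < x -> z < f x.
Proof.
intros B Hz Hl fz Hx. destruct (Rle_dec x M) as [H|H].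
- rewrite <- fz at 1. apply (bm_inc _ _ _ _ B); lra.
- apply Rle_lt_trans with (1 := Hl). apply (bm_tail _ _ _ _ B). lra.
Qed.

Lemma bimodal_comp_continuity_pt f m M l x :
  bimodal f m M l -> 0 < x -> continuity_pt (fun y => f (f y)) x.
Proof.
intros B Hx. apply (continuity_pt_comp f f).
- now apply (bm_cont _ _ _ _ B).
- now apply (bm_cont _ _ _ _ B), (bm_pos _ _ _ _ B).
Qed.

Lemma IVT_fixed_point (g : R -> R) (x y : R) :
  (forall z, x <= z <= y -> continuity_pt g z) -> x < y ->
  x < g x /\ g y < y \/ g x < x /\ y < g y ->
  exists z, x < z < y /\ g z = z.
Proof.
intros Hc Hxy H.
assert (E : exists z, x <= z <= y /\ g z = z).
{ destruct H as [[H1 H2]|[H1 H2]].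
  - destruct (IVT_interv (fun z => z - g z) x y) as [z [Hz E]]; try lra.
    + intros z Hz. apply continuity_pt_minus; [apply derivable_continuous_pt; reg|auto].
    + exists z. split; [assumption|lra].
  - destruct (IVT_interv (fun z => g z - z) x y) as [z [Hz E]]; try lra.
    + intros z Hz. apply continuity_pt_minus; [auto|apply derivable_continuous_pt; reg].
    + exists z. split; [assumption|lra]. }
destruct E as [z [Hz Ez]]. exists z. split; [|assumption].
destruct (Req_dec z x) as [->|]; [lra|]. destruct (Req_dec z y) as [->|]; lra.
Qed.

Lemma orbit_invariant (f : R -> R) (D : R -> Prop) (t : nat -> R) :
  (forall x, D x -> D (f x)) -> D (t 0%nat) -> (forall n, t (S n) = f (t n)) ->
  forall n, D (t n).
Proof. intros Df D0 Ht n. induction n; [|rewrite Ht]; auto. Qed.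

Lemma orbit_iter (f : R -> R) (t : nat -> R) :
  (forall n, t (S n) = f (t n)) -> forall n, t n = Nat.iter n f (t 0%nat).
Proof. intros Ht n. induction n as [|n IH]; simpl; [|rewrite Ht, IH]; reflexivity. Qed.

Lemma eventually_hits_cv (f : R -> R) (z : R) (t : nat -> R) :
  f z = z -> (forall n, t (S n) = f (t n)) -> eventually_hits f z (t 0%nat) -> Un_cv t z.
Proof.
intros fz Ht [_ [N HN]]. rewrite <- (orbit_iter f t Ht) in HN.
apply Un_cv_shift with N.
assert (C : forall n, t (n + N)%nat = z).
{ intros n. induction n as [|n IH]; simpl; [|rewrite Ht, IH]; assumption. }
intros e He. exists 0%nat. intros n _. rewrite C, Rdist_eq. exact He.
Qed.

Lemma cv_odd (f : R -> R) (t : nat -> R) (z : R) :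
  continuity_pt f z -> (forall n, t (S n) = f (t n)) ->
  Un_cv (fun n => t (2 * n)%nat) z -> Un_cv (fun n => t (2 * n + 1)%nat) (f z).
Proof.
intros Hc Ht H. pose proof (continuity_seq f _ _ Hc H) as H'.
intros e He. destruct (H' e He) as [N HN]. exists N. intros n Hn.
rewrite Nat.add_1_r, Ht. now apply HN.
Qed.

Lemma orbit_even (f : R -> R) (t : nat -> R) :
  (forall n, t (S n) = f (t n)) -> forall n, t (2 * S n)%nat = f (f (t (2 * n)%nat)).
Proof. intros Ht n. replace (2 * S n)%nat with (S (S (2 * n))) by lia. now rewrite !Ht. Qed.

(** * Case [c = c_m]: the upper equilibrium attracts from above and repels from below *)

Record semistable_above (f : R -> R) (m M l t1 t2 delta : R) : Prop := {
  sa_bm : bimodal f m M l;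
  sa_t1 : 0 < t1 < t2;
  sa_t2 : m < t2 < M;
  sa_l : t2 <= l;
  sa_f1 : f t1 = t1;
  sa_f2 : f t2 = t2;
  sa_lt : forall x, 0 < x -> x < t1 -> x < f x;
  sa_gt : forall x, t1 < x -> x <> t2 -> f x < x;
  sa_delta : 0 < delta < m;
  sa_fdelta : f delta = t2
}.

(** From [t2] on, the half-line is invariant and orbits descend in it; a start at or below [delta]
    enters it after one step. *)
Lemma semistable_above_cv_t2 f m M l t1 t2 delta t :
  semistable_above f m M l t1 t2 delta ->
  0 < t 0%nat -> (forall n, t (S n) = f (t n)) ->
  ~ (delta < t 0%nat < t2) -> Un_cv t t2.
Proof.
intros [B H1 H2 Hl f1 f2 Hlt Hgt Hd fd] H0 Ht Hout.
assert (main : forall u, t2 <= u 0%nat -> (forall n, u (S n) = f (u n)) -> Un_cv u t2).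
{ intros u Hu Hun.
  assert (Hinv : forall x, t2 <= x -> t2 <= f x).
  { intros x [H|<-]; [|lra]. left. now apply (bimodal_above f m M l). }
  apply log_contraction_cv with f (fun x => t2 <= x); try assumption.
  - lra.
  - intros; lra.
  - intros; lra.
  - intros x Hx. apply (bm_cont _ _ _ _ B). lra.
  - intros; lra.
  - intros x Hx Hx'. assert (f x < x) by (apply Hgt; lra). specialize (Hinv x Hx). split; nra. }
destruct (Rle_dec t2 (t 0%nat)) as [H|H]; [now apply main|].
apply Un_cv_shift with 1%nat. apply main.
- simpl. rewrite Ht, <- fd. apply (bimodal_dec_le f m M l); auto; lra.
- intros n. simpl. apply Ht.
Qed.

(** [[m, t2)] is invariant and [f] is increasing on it, so orbits there approach [t1] monotonically;
    a start in [(delta, m)] enters it after one step. *)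
Lemma semistable_above_cv_t1 f m M l t1 t2 delta t :
  semistable_above f m M l t1 t2 delta ->
  (forall n, t (S n) = f (t n)) -> m <= t1 ->
  delta < t 0%nat < t2 -> Un_cv t t1.
Proof.
intros [B H1 H2 Hl f1 f2 Hlt Hgt Hd fd] Ht Hm Hin.
assert (Hm0 := bm_crit _ _ _ _ B).
assert (Hfm : m <= f m).
{ destruct Hm as [Hm|Hm]; [left; apply Hlt; lra|]. rewrite Hm. lra. }
assert (main : forall u, m <= u 0%nat < t2 -> (forall n, u (S n) = f (u n)) -> Un_cv u t1).
{ intros u Hu Hun.
  apply log_contraction_cv with f (fun x => m <= x < t2); try assumption.
  - lra.
  - intros; lra.
  - intros; lra.
  - intros x Hx. split.
    + apply Rle_trans with (1 := Hfm). apply (bimodal_inc_le f m M l); auto; lra.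
    + rewrite <- f2. apply (bm_inc _ _ _ _ B); lra.
  - intros x Hx. apply (bm_cont _ _ _ _ B). lra.
  - intros x Hx Hx'. assert (x < f x) by (apply Hlt; lra).
    assert (f x < f t1) by (apply (bm_inc _ _ _ _ B); lra). split; nra.
  - intros x Hx Hx'. assert (f x < x) by (apply Hgt; lra).
    assert (f t1 < f x) by (apply (bm_inc _ _ _ _ B); lra). split; nra. }
destruct (Rle_dec m (t 0%nat)) as [H|H]; [apply main; [lra|assumption]|].
apply Un_cv_shift with 1%nat. apply main.
- simpl. rewrite Ht. split.
  + apply Rle_trans with (1 := Hfm). apply (bimodal_dec_le f m M l); auto; lra.
  + rewrite <- fd. apply (bm_dec _ _ _ _ B); lra.
- intros n. simpl. apply Ht.
Qed.

(* If the orbit of the minimum point overshoots [m], then [f o f - id] changes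
   sign between [m] and the point of [(m, t2)] that [f] maps to [t1]. *)
Lemma two_cycle_of_overshoot f m M l t1 t2 delta :
  semistable_above f m M l t1 t2 delta -> t1 < m -> m < f (f m) ->
  exists x, m < x < t2 /\ is_2cycle f x (f x).
Proof.
intros [B H1 H2 Hl f1 f2 Hlt Hgt Hd fd] Hm Hff.
assert (Hm0 := bm_crit _ _ _ _ B).
assert (Hfm : f m < t1) by (rewrite <- f1; apply (bm_dec _ _ _ _ B); lra).
destruct (IVT_interv (fun x => f x - t1) m t2) as [y [Hy Ey]]; try lra.
{ intros x Hx. apply continuity_pt_minus; [apply (bm_cont _ _ _ _ B); lra|].
  apply derivable_continuous_pt; reg. }
assert (Hym : m < y < t2).
{ split; [destruct (Req_dec y m) as [E|]|destruct (Req_dec y t2) as [E|]].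
  all: try (rewrite E in Ey; lra). all: lra. }
destruct (IVT_fixed_point (fun x => f (f x)) m y) as [x [Hx Ex]]; try lra.
- intros x Hx. apply (bimodal_comp_continuity_pt f m M l); auto; lra.
- left. split; [assumption|]. replace (f y) with t1 by lra. lra.
- exists x. split; [lra|]. assert (f x < x) by (apply Hgt; lra).
  repeat split; try lra. apply (bm_pos _ _ _ _ B). lra.
Qed.

(** An orbit avoiding [[f m, m]] would stay in [(m, t2)] from the first step on, hence decrease to a
    fixed point in [[m, t2)], where there is none. *)
Lemma semistable_above_capture f m M l t1 t2 delta t :
  semistable_above f m M l t1 t2 delta -> t1 < m -> f (f m) <= m ->
  (forall n, t (S n) = f (t n)) -> delta < t 0%nat < t2 ->
  exists N, f m <= t N <= m.
Proof.
intros [B H1 H2 Hl f1 f2 Hlt Hgt Hd fd] Hm Hff Ht Hin.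
assert (Hm0 := bm_crit _ _ _ _ B).
assert (Hfm0 : 0 < f m) by (apply (bm_pos _ _ _ _ B); lra).
assert (Hmin : forall x, delta < x < t2 -> f m <= f x < t2).
{ intros x Hx. destruct (Rle_dec x m) as [H|H].
  - split; [apply (bimodal_dec_le f m M l); auto; lra|].
    rewrite <- fd. apply (bm_dec _ _ _ _ B); lra.
  - split; [apply (bimodal_inc_le f m M l); auto; lra|].
    rewrite <- f2. apply (bm_inc _ _ _ _ B); lra. }
(* Otherwise [f (f m) >= f delta = t2 > m]. *)
assert (Hdel : delta < f m).
{ apply Rnot_le_lt. intro H.
  assert (f delta <= f (f m)) by (apply (bimodal_dec_le f m M l); auto; lra). lra. }
assert (Hn' : forall n, delta < t n < t2).
{ apply (orbit_invariant f (fun x => delta < x < t2)); try assumption.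
  intros x Hx. specialize (Hmin x Hx). lra. }
apply NNPP. intro Hno.
(* The index starts at 1: only images are known to be at least [f m], while [t 0] may lie below
   it. *)
assert (Habove : forall n, m < t (S n)).
{ intros n. apply Rnot_le_lt. intro H. apply Hno. exists (S n). split; [|assumption].
  rewrite Ht. apply Hmin, Hn'. }
assert (Ldec : Un_decreasing (fun n => t (S n))).
{ intros n. rewrite (Ht (S n)). left. specialize (Habove n). specialize (Hn' (S n)).
  apply Hgt; lra. }
destruct (decreasing_cv _ Ldec) as [L HL].
- exists 0. intros y [n ->]. unfold opp_seq. specialize (Habove n). lra.
- assert (HLm : m <= L).
  { apply Rnot_lt_le. intro H. destruct (HL (m - L)) as [N HN]; [lra|].
    specialize (HN N (le_n N)). unfold Rdist in HN. apply Rabs_def2 in HN.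
    specialize (Habove N). lra. }
  assert (HLt := decreasing_ineq _ _ Ldec HL 0%nat). simpl in HLt.
  specialize (Hn' 1%nat).
  assert (HfL : f L = L).
  { apply (UL_sequence (fun n => f (t (S n)))).
    - apply continuity_seq; [apply (bm_cont _ _ _ _ B); lra|exact HL].
    - intros e He. destruct (HL e He) as [N HN]. exists N. intros n Hge.
      rewrite <- Ht. apply HN. lia. }
  assert (f L < L) by (apply Hgt; lra). lra.
Qed.

Lemma semistable_above_core f m M l t1 t2 delta x :
  semistable_above f m M l t1 t2 delta -> t1 < m -> f (f m) <= m ->
  f m <= x <= m -> f m <= f x <= m.
Proof.
intros [B H1 H2 Hl f1 f2 Hlt Hgt Hd fd] Hm Hff Hx.
assert (Hm0 := bm_crit _ _ _ _ B).
assert (Hfm0 : 0 < f m) by (apply (bm_pos _ _ _ _ B); lra).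
split; [|apply Rle_trans with (2 := Hff)]; apply (bimodal_dec_le f m M l); auto; lra.
Qed.

(** Without 2-cycles [f o f - id] has no zero on [(t1, m]], so it keeps the negative sign it has at
    [m]. On the core [f o f] is increasing, so even iterates tend monotonically to [t1]; odd ones
    follow by continuity. *)
Lemma no_2cycle_cv_t1 f m M l t1 t2 delta t :
  semistable_above f m M l t1 t2 delta -> t1 < m ->
  (forall p q, ~ is_2cycle f p q) ->
  (forall n, t (S n) = f (t n)) -> delta < t 0%nat < t2 -> Un_cv t t1.
Proof.
intros SA Hm Hno Ht Hin. pose proof SA as [B H1 H2 Hl f1 f2 Hlt Hgt Hd fd].
assert (Hm0 := bm_crit _ _ _ _ B).
assert (Hfm0 : 0 < f m) by (apply (bm_pos _ _ _ _ B); lra).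
assert (Hfm : f m < t1) by (rewrite <- f1; apply (bm_dec _ _ _ _ B); lra).
assert (nofix : forall x, t1 < x <= m -> f (f x) <> x).
{ intros x Hx E. apply (Hno x (f x)). assert (f x < x) by (apply Hgt; lra).
  repeat split; try lra. apply (bm_pos _ _ _ _ B). lra. }
assert (Hff : f (f m) < m).
{ destruct (Rtotal_order (f (f m)) m) as [H|[H|H]]; [assumption| |].
  - exfalso. apply (nofix m); [lra|assumption].
  - destruct (two_cycle_of_overshoot f m M l t1 t2 delta SA Hm H) as [x [_ Hx]].
    exfalso. now apply (Hno x (f x)). }
assert (core := fun x => semistable_above_core f m M l t1 t2 delta x SA Hm (Rlt_le _ _ Hff)).
assert (ff_gt : forall x, t1 < x <= m -> f (f x) < x).
{ intros x Hx. destruct (Rtotal_order (f (f x)) x) as [H|[H|H]]; [assumption| |].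
  - exfalso. now apply (nofix x).
  - destruct (Req_dec x m) as [->|Hxm]; [assumption|].
    destruct (IVT_fixed_point (fun y => f (f y)) x m) as [y [Hy E]]; try lra.
    + intros y Hy. apply (bimodal_comp_continuity_pt f m M l); auto; lra.
    + exfalso. apply (nofix y); [lra|assumption]. }
(* The sign left of [t1] is transported by [f]: from [f (f x) <= x] the decreasing branch gives
   [f (f (f x)) >= f x], against [ff_gt] at [f x]. *)
assert (ff_lt : forall x, f m <= x < t1 -> x < f (f x)).
{ intros x Hx. apply Rnot_le_lt. intro H.
  assert (f t1 < f x) by (apply (bm_dec _ _ _ _ B); lra).
  assert (Hc := core x ltac:(lra)).
  assert (Hg := ff_gt (f x) ltac:(lra)).
  assert (Hff0 : 0 < f (f x)) by (apply (bm_pos _ _ _ _ B), (bm_pos _ _ _ _ B); lra).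
  assert (f x <= f (f (f x))) by (apply (bimodal_dec_le f m M l); auto; lra). lra. }
destruct (semistable_above_capture f m M l t1 t2 delta t SA Hm (Rlt_le _ _ Hff) Ht Hin) as [N HN].
apply Un_cv_shift with N.
assert (Hev : Un_cv (fun n => t (2 * n + N)%nat) t1).
{ apply log_contraction_cv with (fun x => f (f x)) (fun x => f m <= x <= m).
  - lra.
  - now rewrite !f1.
  - intros; lra.
  - intros; lra.
  - intros x Hx. now apply core, core.
  - intros x Hx. apply (bimodal_comp_continuity_pt f m M l); auto; lra.
  - intros x Hx Hx'. assert (x < f (f x)) by (apply ff_lt; lra).
    assert (f t1 < f x) by (apply (bm_dec _ _ _ _ B); lra).
    assert (Hc := core x Hx).
    assert (f (f x) < f t1) by (apply (bm_dec _ _ _ _ B); lra). split; nra.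
  - intros x Hx Hx'. assert (f (f x) < x) by (apply ff_gt; lra).
    assert (f x < f t1) by (apply (bm_dec _ _ _ _ B); lra).
    assert (Hc := core x Hx).
    assert (f t1 < f (f x)) by (apply (bm_dec _ _ _ _ B); lra). split; nra.
  - exact HN.
  - intros n. apply (orbit_even f (fun k => t (k + N)%nat)). intros k. apply Ht. }
apply Un_cv_even_odd; [exact Hev|].
rewrite <- f1. apply (cv_odd f (fun k => t (k + N)%nat)).
- apply (bm_cont _ _ _ _ B). lra.
- intros k. apply Ht.
- exact Hev.
Qed.

(** An overshoot would create a 2-cycle with a point beyond [m], while [p] and [q] are both at most
    [m]. *)
Lemma only_2cycle_overshoot f m M l t1 t2 delta p q :
  semistable_above f m M l t1 t2 delta -> t1 < m ->
  p < t1 -> q <= m ->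
  (forall p' q', is_2cycle f p' q' -> (p' = p /\ q' = q) \/ (p' = q /\ q' = p)) ->
  f (f m) <= m.
Proof.
intros SA Hm Hp Hq Huniq. apply Rnot_lt_le. intro H.
destruct (two_cycle_of_overshoot f m M l t1 t2 delta SA Hm H) as [x [Hx Hc]].
destruct (Huniq x (f x) Hc); lra.
Qed.

(** On [(t1, m]] the increasing map [f o f] has [q] as its only fixed point. Above [q] the sign of
    [f o f - id] is read off at [m]; below [q] it is decided by the local attraction hypothesis. *)
Lemma core_cv_2cycle f m M l t1 t2 delta p q t :
  semistable_above f m M l t1 t2 delta -> t1 < m ->
  is_2cycle f p q -> p < t1 -> t1 < q -> q <= m ->
  (forall p' q', is_2cycle f p' q' -> (p' = p /\ q' = q) \/ (p' = q /\ q' = p)) ->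
  (exists e, 0 < e /\ forall x, q - e < x < q -> x < f (f x)) ->
  (forall n, t (S n) = f (t n)) -> f m <= t 0%nat <= m -> t 0%nat <> t1 ->
  cv_2cycle t p q.
Proof.
intros SA Hm [Hp0 [Hq0 [Hpq [fp fq]]]] Hp Hq Hqm Huniq [e [He Hnear]] Ht Hin Hne.
assert (Hff := only_2cycle_overshoot f m M l t1 t2 delta p q SA Hm Hp Hqm Huniq).
pose proof SA as [B H1 H2 Hl f1 f2 Hlt Hgt Hd fd].
assert (Hm0 := bm_crit _ _ _ _ B).
assert (Hfm0 : 0 < f m) by (apply (bm_pos _ _ _ _ B); lra).
assert (core := fun x => semistable_above_core f m M l t1 t2 delta x SA Hm Hff).
assert (onlyq : forall x, t1 < x <= m -> f (f x) = x -> x = q).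
{ intros x Hx E. destruct (Huniq x (f x)) as [H|H]; try lra.
  assert (f x < x) by (apply Hgt; lra).
  repeat split; try lra. apply (bm_pos _ _ _ _ B). lra. }
assert (ff_hi : forall x, q < x <= m -> f (f x) < x).
{ intros x Hx.
  assert (Hffm : f (f m) < m).
  { destruct Hff as [H|H]; [assumption|]. assert (m = q) by (apply onlyq; lra). lra. }
  destruct (Rtotal_order (f (f x)) x) as [H|[H|H]]; [assumption| |].
  - assert (x = q) by (apply onlyq; lra). lra.
  - destruct (Req_dec x m) as [->|Hxm]; [assumption|].
    destruct (IVT_fixed_point (fun y => f (f y)) x m) as [y [Hy E]]; try lra.
    + intros y Hy. apply (bimodal_comp_continuity_pt f m M l); auto; lra.
    + assert (y = q) by (apply onlyq; lra). lra. }
assert (ff_lo : forall x, t1 < x < q -> x < f (f x)).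
{ intros x Hx. destruct (Rtotal_order (f (f x)) x) as [H|[H|H]]; [| |assumption].
  (* [y] lies in [(x, q)] and within [e] of [q], so [f o f - id] would change sign between [x] and
     [y] and vanish there. *)
  - set (y := (Rmax x (q - e) + q) / 2).
    pose proof (Rmax_l x (q - e)). pose proof (Rmax_r x (q - e)).
    assert (Rmax x (q - e) < q) by (apply Rmax_lub_lt; lra).
    assert (Hy : q - e < y < q) by (unfold y; lra).
    assert (Hxy : x < y) by (unfold y; lra).
    assert (Hfy := Hnear y Hy).
    destruct (IVT_fixed_point (fun y => f (f y)) x y) as [w [Hw E]]; try lra.
    + intros w Hw. apply (bimodal_comp_continuity_pt f m M l); auto; lra.
    + assert (w = q) by (apply onlyq; lra). lra.
  - assert (x = q) by (apply onlyq; lra). lra. }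
assert (main : forall u, t1 < u 0%nat <= m -> (forall n, u (S n) = f (u n)) -> cv_2cycle u p q).
{ intros u Hu Hun.
  assert (Hfm : f m < t1) by (rewrite <- f1; apply (bm_dec _ _ _ _ B); lra).
  assert (Hev : Un_cv (fun n => u (2 * n)%nat) q).
  { apply log_contraction_cv with (fun x => f (f x)) (fun x => t1 < x <= m).
    - lra.
    - now rewrite fq.
    - intros; lra.
    - intros; lra.
    - intros x Hx. assert (f x < f t1) by (apply (bm_dec _ _ _ _ B); lra).
      assert (Hc := core x ltac:(lra)). split; [|now apply core].
      rewrite <- f1. apply (bm_dec _ _ _ _ B); lra.
    - intros x Hx. apply (bimodal_comp_continuity_pt f m M l); auto; lra.
    - intros x Hx Hx'. assert (x < f (f x)) by (apply ff_lo; lra).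
      assert (Hc := core x ltac:(lra)).
      assert (f q < f x) by (apply (bm_dec _ _ _ _ B); lra).
      assert (f (f x) < f (f q)) by (apply (bm_dec _ _ _ _ B); lra).
      rewrite fq, fp in *. split; nra.
    - intros x Hx Hx'. assert (f (f x) < x) by (apply ff_hi; lra).
      assert (Hc := core x ltac:(lra)).
      assert (f x < f q) by (apply (bm_dec _ _ _ _ B); lra).
      assert (f (f q) < f (f x)) by (apply (bm_dec _ _ _ _ B); lra).
      rewrite fq, fp in *. split; nra.
    - exact Hu.
    - intros n. now apply (orbit_even f u). }
  right. split; [exact Hev|].
  rewrite <- fq. apply cv_odd; [|assumption|exact Hev]. now apply (bm_cont _ _ _ _ B). }
destruct (Rlt_dec t1 (t 0%nat)) as [H|H]; [apply main; [lra|assumption]|].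
(* A start below [t1] is mapped above [t1], exchanging the parities. *)
apply cv_2cycle_shift with 1%nat. apply main.
- simpl. rewrite Ht. split; [|now apply core].
  rewrite <- f1. apply (bm_dec _ _ _ _ B); lra.
- intros n. simpl. apply Ht.
Qed.

Lemma semistable_above_cv_2cycle f m M l t1 t2 delta p q t :
  semistable_above f m M l t1 t2 delta -> t1 < m ->
  is_2cycle f p q -> p < t1 -> t1 < q -> q <= m ->
  (forall p' q', is_2cycle f p' q' -> (p' = p /\ q' = q) \/ (p' = q /\ q' = p)) ->
  (exists e, 0 < e /\ forall x, q - e < x < q -> x < f (f x)) ->
  (forall n, t (S n) = f (t n)) -> delta < t 0%nat < t2 ->
  ~ eventually_hits f t1 (t 0%nat) -> cv_2cycle t p q.
Proof.
intros SA Hm Hpq Hp Hq Hqm Huniq Hnear Ht Hin Hno.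
assert (Hff := only_2cycle_overshoot f m M l t1 t2 delta p q SA Hm Hp Hqm Huniq).
destruct (semistable_above_capture f m M l t1 t2 delta t SA Hm Hff Ht Hin) as [N HN].
apply cv_2cycle_shift with N.
apply (core_cv_2cycle f m M l t1 t2 delta); try assumption.
- intros n. apply Ht.
- intro E. apply Hno. split.
  + pose proof (sa_delta _ _ _ _ _ _ _ SA). lra.
  + exists N. rewrite <- (orbit_iter f t Ht). exact E.
Qed.

(** * Case [c = c_M]: the lower equilibrium attracts from below and repels from above *)

Record semistable_below (f : R -> R) (m M l t1 t2 delta : R) : Prop := {
  sb_bm : bimodal f m M l;
  sb_t1 : m < t1 < M;
  sb_t2 : t1 < t2;
  sb_l : t1 <= l;
  sb_f1 : f t1 = t1;
  sb_f2 : f t2 = t2;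
  sb_lt : forall x, 0 < x -> x < t2 -> x <> t1 -> x < f x;
  sb_gt : forall x, t2 < x -> f x < x;
  sb_mul : forall x y, m <= x -> x < y -> x * f x < y * f y;
  sb_delta : 0 < delta < m;
  sb_fdelta : f delta = t1
}.

Lemma semistable_below_cv_t1 f m M l t1 t2 delta t :
  semistable_below f m M l t1 t2 delta ->
  (forall n, t (S n) = f (t n)) -> delta <= t 0%nat <= t1 -> Un_cv t t1.
Proof.
intros [B H1 H2 Hl f1 f2 Hlt Hgt Hmul Hd fd] Ht Hin.
assert (Hm0 := bm_crit _ _ _ _ B).
assert (Hfm : m < f m) by (apply Hlt; lra).
assert (main : forall u, m <= u 0%nat <= t1 -> (forall n, u (S n) = f (u n)) -> Un_cv u t1).
{ intros u Hu Hun.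
  assert (Hinv : forall x, m <= x <= t1 -> m <= f x <= t1).
  { intros x Hx. split.
    - apply Rle_trans with (f m); [lra|]. apply (bimodal_inc_le f m M l); auto; lra.
    - rewrite <- f1. apply (bimodal_inc_le f m M l); auto; lra. }
  apply log_contraction_cv with f (fun x => m <= x <= t1); try assumption.
  - lra.
  - intros; lra.
  - intros; lra.
  - intros x Hx. apply (bm_cont _ _ _ _ B). lra.
  - intros x Hx Hx'. assert (x < f x) by (apply Hlt; lra). specialize (Hinv x Hx). split; nra.
  - intros; lra. }
destruct (Rle_dec m (t 0%nat)) as [H|H]; [apply main; [lra|assumption]|].
apply Un_cv_shift with 1%nat. apply main.
- simpl. rewrite Ht. split.
  + apply Rle_trans with (f m); [lra|]. apply (bimodal_dec_le f m M l); auto; lra.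
  + rewrite <- fd. apply (bimodal_dec_le f m M l); auto; lra.
- intros n. simpl. apply Ht.
Qed.

(** Past [M] orbits may alternate around [t2], so monotonicity is replaced by contraction of the
    logarithmic distance: [sb_mul] compares [x * f x] with [t2 * f t2 = t2^2]. A start below [delta]
    jumps above [t1] in one step. *)
Lemma semistable_below_cv_t2 f m M l t1 t2 delta t :
  semistable_below f m M l t1 t2 delta ->
  0 < t 0%nat -> (forall n, t (S n) = f (t n)) ->
  ~ (delta <= t 0%nat <= t1) -> Un_cv t t2.
Proof.
intros [B H1 H2 Hl f1 f2 Hlt Hgt Hmul Hd fd] H0 Ht Hout.
assert (Hm0 := bm_crit _ _ _ _ B).
assert (main : forall u, t1 < u 0%nat -> (forall n, u (S n) = f (u n)) -> Un_cv u t2).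
{ intros u Hu Hun.
  apply log_contraction_cv with f (fun x => t1 < x); try assumption.
  - intros; lra.
  - intros; lra.
  - intros x Hx. now apply (bimodal_above f m M l).
  - intros x Hx. apply (bm_cont _ _ _ _ B). lra.
  - intros x Hx Hx'. split; [apply Hlt; lra|].
    replace (t2^2) with (t2 * f t2) by (rewrite f2; ring). apply Hmul; lra.
  - intros x Hx Hx'. split; [apply Hgt; lra|].
    replace (t2^2) with (t2 * f t2) by (rewrite f2; ring). apply Hmul; lra. }
destruct (Rlt_dec t1 (t 0%nat)) as [H|H]; [now apply main|].
apply Un_cv_shift with 1%nat. apply main.
- simpl. rewrite Ht, <- fd. apply (bm_dec _ _ _ _ B); lra.
- intros n. simpl. apply Ht.
Qed.

(** * Locating the double root of [P] *)

(** A double root at [t1] would make [P] negative between [t1] and [t2], so [t1] could not be a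
    local minimum. *)
Lemma double_root_min_right a b c d t1 t2 z : 0 < d -> 0 < t1 < t2 ->
  Pq a b c d t1 = 0 -> Pq a b c d t2 = 0 -> z = t1 \/ z = t2 ->
  dPq a b c d z = 0 -> local_min (Pq a b c d) z -> z = t2.
Proof.
intros Hd Ht P1 P2 [->| ->] Dz [e [He Hmin]]; [exfalso|reflexivity].
destruct (Pq_factor a b c d t1 t2) as [s [Hs F]]; try assumption; try lra.
set (h := Rmin e (t2 - t1)).
assert (0 < h) by (apply Rmin_glb_lt; lra).
assert (h <= e) by apply Rmin_l. assert (h <= t2 - t1) by apply Rmin_r.
specialize (Hmin (t1 + h / 2)). rewrite P1, F in Hmin.
assert (0 <= (t1 + h / 2 - t1)^2 * (t1 + h / 2 - t2) * (t1 + h / 2 + s)).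
{ apply Hmin. apply Rabs_def1; lra. }
assert (0 < (t1 + h / 2 - t1)^2 * (t2 - (t1 + h / 2)) * (t1 + h / 2 + s)).
{ repeat apply Rmult_lt_0_compat; nra. }
lra.
Qed.

Lemma double_root_max_left a b c d t1 t2 z : 0 < d -> 0 < t1 < t2 ->
  Pq a b c d t1 = 0 -> Pq a b c d t2 = 0 -> z = t1 \/ z = t2 ->
  dPq a b c d z = 0 -> local_max (Pq a b c d) z -> z = t1.
Proof.
intros Hd Ht P1 P2 [->| ->] Dz [e [He Hmax]]; [reflexivity|exfalso].
destruct (Pq_factor a b c d t2 t1) as [s [Hs F]]; try assumption; try lra.
specialize (Hmax (t2 + e / 2)). rewrite P2, F in Hmax.
assert ((t2 + e / 2 - t2)^2 * (t2 + e / 2 - t1) * (t2 + e / 2 + s) <= 0).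
{ apply Hmax. apply Rabs_def1; lra. }
assert (0 < (t2 + e / 2 - t2)^2 * (t2 + e / 2 - t1) * (t2 + e / 2 + s)).
{ repeat apply Rmult_lt_0_compat; nra. }
lra.
Qed.

(* At a double root [z] of [P = x^3 (x - phi x)] we have [phi' z = 1]. *)
Lemma double_root_between a b c d m M z : 0 < b -> 0 < z -> 0 < m < M ->
  c = - b * (m + M) / 2 -> d = b * m * M / 3 ->
  Pq a b c d z = 0 -> dPq a b c d z = 0 -> m < z < M.
Proof.
intros Hb Hz HmM Ec Ed Pz Dz.
assert (E : b * ((z - m) * (z - M)) = - z^4).
(* The combination [z P' - 3 P] eliminates [a] and equals [z^4 + b z^2 + 2 c z + 3 d]. *)
{ transitivity (z * dPq a b c d z - 3 * Pq a b c d z - z^4); [|rewrite Pz, Dz; ring].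
  unfold Pq, dPq. subst c d. field. }
assert (0 < z^4) by now apply pow_lt.
assert ((z - m) * (z - M) < 0) by nra.
split; apply Rnot_le_lt; intro; nra.
Qed.

Lemma phi_sub_id_sign a b c d x : 0 < x ->
  (0 < Pq a b c d x -> phi a b c d x < x) /\ (Pq a b c d x < 0 -> x < phi a b c d x).
Proof.
intros Hx. rewrite Pq_phi by assumption. assert (0 < x^3) by now apply pow_lt. split; nra.
Qed.

Lemma phi_fixed_Pq a b c d x : 0 < x -> (phi a b c d x = x <-> Pq a b c d x = 0).
Proof.
intros Hx. rewrite Pq_phi by assumption. split; intro H.
- rewrite H. ring.
- apply Rmult_integral in H. destruct H as [H|H]; [|lra].
  exfalso. revert H. apply pow_nonzero. lra.
Qed.

Lemma phi_bimodal a b c d m M : 0 < b -> 0 < m < M ->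
  c = - b * (m + M) / 2 -> d = b * m * M / 3 ->
  (forall x, 0 < x -> 0 < phi a b c d x) -> bimodal (phi a b c d) m M a.
Proof.
intros Hb HmM Ec Ed Hpos. split; try assumption.
- intros. now apply phi_continuity_pt.
- intros. apply phi_decreasing with m M; auto.
- intros. apply phi_increasing with m M; auto.
- intros. apply phi_tail with m M; auto.
Qed.

Theorem theorem7 (a b c d cminus t1 t2 : R) (t : nat -> R) :
  0 < a -> 0 < b -> 0 < d ->
  (* c_- is the unique negative zero of Q *)
  cminus < 0 -> Qc a b d cminus = 0 ->
  (forall x, x < 0 -> Qc a b d x = 0 -> x = cminus) ->
  cminus < c -> c < cstar b d ->
  (* phi has exactly the two equilibria t1 < t2 *)
  0 < t1 -> t1 < t2 -> phi a b c d t1 = t1 -> phi a b c d t2 = t2 ->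
  (forall x, 0 < x -> phi a b c d x = x -> x = t1 \/ x = t2) ->
  (* {t_n} is a positive solution *)
  0 < t 0%nat -> (forall n, t (S n) = phi a b c d (t n)) ->
  (* (a) case c = c_m *)
  (is_cm a b d c -> t2 <= a ->
   forall delta, 0 < delta -> delta < xm a b c d -> phi a b c d delta = t2 ->
   (forall y, 0 < y -> y < xm a b c d -> phi a b c d y = t2 -> y = delta) ->
   (* (a1) *)
   (xm a b c d <= t1 ->
      (delta < t 0%nat < t2 -> Un_cv t t1) /\
      (~ (delta < t 0%nat < t2) -> Un_cv t t2)) /\
   (* (a2) *)
   (t1 < xm a b c d ->
      (* (a21) *)
      ((forall p q, ~ is_2cycle (phi a b c d) p q) ->
         (delta < t 0%nat < t2 -> Un_cv t t1) /\
         (~ (delta < t 0%nat < t2) -> Un_cv t t2)) /\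
      (* (a22) *)
      (forall p q, is_2cycle (phi a b c d) p q ->
         p < t1 -> t1 < q -> q <= xm a b c d ->
         (forall p' q', is_2cycle (phi a b c d) p' q' ->
            (p' = p /\ q' = q) \/ (p' = q /\ q' = p)) ->
         ((delta < t 0%nat < t2 /\ ~ eventually_hits (phi a b c d) t1 (t 0%nat)) ->
            cv_2cycle t p q) /\
         (eventually_hits (phi a b c d) t1 (t 0%nat) -> Un_cv t t1) /\
         ((~ (delta < t 0%nat < t2) /\ ~ eventually_hits (phi a b c d) t1 (t 0%nat)) ->
            Un_cv t t2) /\
         ((phi a b c d (xm a b c d) <= t 0%nat
             <= phi a b c d (phi a b c d (xm a b c d)) /\ t 0%nat <> t1) ->
            cv_2cycle t p q)))) /\
  (* (b) case c = c_M *)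
  (is_cM a b d c -> t1 <= a ->
   forall delta', 0 < delta' -> delta' < xm a b c d -> phi a b c d delta' = t1 ->
   (forall y, 0 < y -> y < xm a b c d -> phi a b c d y = t1 -> y = delta') ->
   (delta' <= t 0%nat <= t1 -> Un_cv t t1) /\
   (~ (delta' <= t 0%nat <= t1) -> Un_cv t t2)).
Proof.
intros Ha Hb Hd _ _ HQ Hcm Hcs Ht1 Ht12 f1 f2 Hfix H0 Ht.
assert (Hpos : forall x, 0 < x -> 0 < phi a b c d x).
{ intros x Hx. apply phi_pos; [assumption|]. now apply (cubic_pos a b c d cminus). }
destruct (xm_spec a b c d Hb Hd Hcs) as [M [HmM [Ec Ed]]].
set (m := xm a b c d) in *. set (f := phi a b c d) in *.
assert (B : bimodal f m M a) by now apply phi_bimodal.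
assert (P1 : Pq a b c d t1 = 0) by (apply phi_fixed_Pq; assumption).
assert (P2 : Pq a b c d t2 = 0) by (apply phi_fixed_Pq; [lra|assumption]).
split.
- intros [_ [_ [_ [_ [[z [Hz [Pz [Dz Hmin]]]] _]]]]] Hl delta Hd0 Hdm fd _.
  (* The double root is an equilibrium, hence [t1] or [t2], and being a local minimum of [P] selects
     the larger. *)
  assert (Ez : z = t2).
  { apply (double_root_min_right a b c d t1 t2); auto. apply Hfix; [assumption|].
    now apply phi_fixed_Pq. }
  subst z.
  assert (HtM := double_root_between a b c d m M t2 Hb Hz HmM Ec Ed P2 Dz).
  destruct (Pq_factor a b c d t2 t1) as [s [Hs F]]; try assumption; try lra.
  assert (SA : semistable_above f m M a t1 t2 delta).
  { split; auto.
    - intros x Hx Hx1. apply phi_sub_id_sign; [assumption|]. rewrite F.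
      assert (0 < (x - t2)^2) by (rewrite <- Rsqr_pow2; apply Rlt_0_sqr; lra).
      assert (0 < (x - t2)^2 * (t1 - x) * (x + s)); [|lra].
      apply Rmult_lt_0_compat; [apply Rmult_lt_0_compat|]; lra.
    - intros x Hx Hx2. apply phi_sub_id_sign; [lra|]. rewrite F.
      assert (0 < (x - t2)^2) by (rewrite <- Rsqr_pow2; apply Rlt_0_sqr; lra).
      apply Rmult_lt_0_compat; [apply Rmult_lt_0_compat|]; lra. }
  assert (Hout := semistable_above_cv_t2 f m M a t1 t2 delta t SA H0 Ht).
  split.
  + intros Hm. split; [|exact Hout]. now apply (semistable_above_cv_t1 f m M a t1 t2 delta).
  + intros Hm. split.
    * intros Hno. split; [|exact Hout]. now apply (no_2cycle_cv_t1 f m M a t1 t2 delta).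
    * intros p q Hpq Hp Hq Hqm Huniq.
      assert (Hnear := two_cycle_attracting a b c d m M p q Hb HmM Ec Ed Hpq ltac:(lra) Hqm).
      split; [|split; [|split]].
      -- intros [Hin Hno]. now apply (semistable_above_cv_2cycle f m M a t1 t2 delta).
      -- now apply eventually_hits_cv.
      -- intros [Hn _]. now apply Hout.
      -- intros [HI Hne].
         (* Since [f (f m) <= m], the interval [I] lies in the core [[f m, m]]. *)
         pose proof (only_2cycle_overshoot f m M a t1 t2 delta p q SA Hm Hp Hqm Huniq).
         apply (core_cv_2cycle f m M a t1 t2 delta); auto. lra.
- intros [cb [cm [_ [_ [_ [_ [[z [Hz [Pz [Dz Hmax]]]] _]]]]]]] Hl delta Hd0 Hdm fd _.
  assert (Ez : z = t1).
  { apply (double_root_max_left a b c d t1 t2); auto. apply Hfix; [assumption|].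
    now apply phi_fixed_Pq. }
  subst z.
  assert (HtM := double_root_between a b c d m M t1 Hb Hz HmM Ec Ed P1 Dz).
  destruct (Pq_factor a b c d t1 t2) as [s [Hs F]]; try assumption; try lra.
  assert (SB : semistable_below f m M a t1 t2 delta).
  { split; auto.
    - intros x Hx Hx2 Hx1. apply phi_sub_id_sign; [assumption|]. rewrite F.
      assert (0 < (x - t1)^2) by (rewrite <- Rsqr_pow2; apply Rlt_0_sqr; lra).
      assert (0 < (x - t1)^2 * (t2 - x) * (x + s)); [|lra].
      apply Rmult_lt_0_compat; [apply Rmult_lt_0_compat|]; lra.
    - intros x Hx. apply phi_sub_id_sign; [lra|]. rewrite F.
      assert (0 < (x - t1)^2) by (rewrite <- Rsqr_pow2; apply Rlt_0_sqr; lra).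
      apply Rmult_lt_0_compat; [apply Rmult_lt_0_compat|]; lra.
    - intros x y Hx Hxy. now apply (mul_phi_increasing a b c d m M). }
  split.
  + now apply (semistable_below_cv_t1 f m M a t1 t2 delta).
  + now apply (semistable_below_cv_t2 f m M a t1 t2 delta).
Qed.
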